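(* Let $n\ge 2$ be an integer, let $f=(f_1,\ldots,f_n)$ be a sequence of symbols with degrees $|f|=(|f_1|,\ldots,|f_n|)\in\mathbb{Z}^n$, and let $\mathcal{E}_f$ be the set of permutations of $f$. Let $F_{n-1}$ be the free group on $s_1,\ldots,s_{n-1}$, let $\kappa: F_{n-1}\times\mathcal{E}_f\to\{\pm1\}$ be the map defined in the context, and let $\pi:F_{n-1}\to S_n$ be the surjective group morphism sending $s_i$ to the transposition $(i,i+1)$. Then $\kappa$ induces a map $\kappa: S_n\times\mathcal{E}_f\to\{\pm1\}$; that is, there is a well-defined map $S_n\times\mathcal{E}_f\to\{\pm1\}$ whose value at $(\pi(x),g)$ is $\kappa(x,g)$ for all $x\in F_{n-1}$ and $g\in\mathcal{E}_f$ (equivalently, $\kappa(x,g)=\kappa(y,g)$ whenever $\pi(x)=\pi(y)$).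
   Context: Symbols are elements of a set in which each element $s$ is assigned a degree $|s|\in\mathbb{Z}$. Fix $n\ge2$ and a sequence of symbols $f=(f_1,\ldots,f_n)$. The set of permutations of $f$ is $$\mathcal{E}_f=\{g=(g_1,\ldots,g_n)\,:\,\exists\rho\in S_n,\ g_i=f_{\rho^{-1}(i)}\text{ for } i=1,\ldots,n\},$$ where $S_n$ is the group of permutations of $\{1,\ldots,n\}$; accordingly $|g_i|=|f_{\rho^{-1}(i)}|$. Let $F_{n-1}$ be the free group on generators $s_1,\ldots,s_{n-1}$, with unit $e$. It acts on $\mathcal{E}_f$ on the left by $$s_i(g)=s_i^{-1}(g)=(g_1,\ldots,g_{i-1},g_{i+1},g_i,g_{i+2},\ldots,g_n).$$ The group $S_n$ is the quotient of $F_{n-1}$ by the relations $s_i^2=e$, $s_is_j=s_js_i$ if $|i-j|>1$, and $s_is_{i+1}s_i=s_{i+1}s_is_{i+1}$, the image of $s_i$ being the transposition $(i,i+1)$. The map $\kappa:F_{n-1}\times\mathcal{E}_f\to\{\pm1\}$ is defined as follows: $\kappa(e,g)=1$; $\kappa(s_i,g)=\kappa(s_i^{-1},g)=(-1)^{|g_i||g_{i+1}|}$ for $1\le i\le n-1$; and if $x=t_{i_1}\cdots t_{i_m}$ is the reduced form of $x\in F_{n-1}$, where each $t_{i_j}$ is $s_{i_j}$ or $s_{i_j}^{-1}$ and no two consecutive factors are inverse to each other, then $$\kappa(x,g)=\kappa(t_{i_1},t_{i_2}\cdots t_{i_m}(g))\,\kappa(t_{i_2},t_{i_3}\cdots t_{i_m}(g))\cdots\kappa(t_{i_m},g).$$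 *)

(* Defs.v *)
From HB Require Import structures.
From mathcomp Require Import all_boot all_order all_algebra all_fingroup.

Set Implicit Arguments.
Unset Strict Implicit.
Unset Printing Implicit Defensive.

Import GRing.Theory.
Local Open Scope ring_scope.

(* The free group on I, as reduced words; the letter (i, true) is the generator
   i and the letter (i, false) its inverse. *)
Section FreeGroup.
Variable I : choiceType.

Definition letter_inv (t : I * bool) : I * bool := (t.1, ~~ t.2).

Definition reduced (w : seq (I * bool)) : bool :=
  sorted (fun t u => u != letter_inv t) w.

Record free_group := FreeGroup {
  word_of :> seq (I * bool);
  word_of_reduced : reduced word_of
}.

HB.instance Definition _ := [isSub for word_of].
HB.instance Definition _ := [Choice of free_group by <:].

Lemma letter_invK : involutive letter_inv.
Proof. by case=> i b; rewrite /letter_inv /= negbK. Qed.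

(* The reduced form of the product of the letter t with the reduced word w. *)
Definition cons_letter (t : I * bool) (w : seq (I * bool)) :=
  if w is u :: w' then if u == letter_inv t then w' else t :: w else [:: t].

Lemma cons_letter_reduced t w : reduced w -> reduced (cons_letter t w).
Proof.
case: w => [//|u w] /= rw; case: eqP => [_|/eqP ne]; last by rewrite /= ne.
exact: path_sorted rw.
Qed.

Lemma foldr_reduced w v : reduced v -> reduced (foldr cons_letter v w).
Proof. by move=> rv; elim: w => //= t w; exact: cons_letter_reduced. Qed.

Lemma cons_letterK t w :
  reduced w -> cons_letter t (cons_letter (letter_inv t) w) = w.
Proof.
case: w => [|u w] /=; first by rewrite eqxx.
rewrite letter_invK; have [->|ne] := eqVneq u t; last by rewrite /= eqxx.
by case: w => [//|v w] /= /andP[/negbTE ->].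
Qed.

Lemma foldr_cons_letter t w v : reduced v ->
  foldr cons_letter v (cons_letter t w)
  = cons_letter t (foldr cons_letter v w).
Proof.
move=> rv; case: w => //= u w; case: eqP => [->|//].
by rewrite cons_letterK // foldr_reduced.
Qed.

Lemma foldr_word w : reduced w -> foldr cons_letter [::] w = w.
Proof.
elim: w => //= t w IH rw; rewrite (IH (path_sorted rw)).
by case: w rw {IH} => //= u w /andP[/negbTE ->].
Qed.

Definition free_mul (x y : free_group) : free_group :=
  FreeGroup (foldr_reduced x (word_of_reduced y)).

Definition free_one : free_group := @FreeGroup [::] isT.

Lemma word_inv_reduced w : reduced w -> reduced (rev (map letter_inv w)).
Proof.
rewrite /reduced rev_sorted sorted_map; apply: sub_sorted => t u /=.
by rewrite letter_invK eq_sym.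
Qed.

Definition free_inv (x : free_group) : free_group :=
  FreeGroup (word_inv_reduced (word_of_reduced x)).

Lemma free_mulA : associative free_mul.
Proof.
move=> x y z; apply/val_inj; rewrite /=.
elim: (word_of x) => //= t w ->.
by rewrite foldr_cons_letter // word_of_reduced.
Qed.

Lemma free_mul1 : left_id free_one free_mul.
Proof. by move=> x; apply/val_inj. Qed.

Lemma free_mulr1 : right_id free_one free_mul.
Proof. by move=> x; apply/val_inj/foldr_word/word_of_reduced. Qed.

Lemma free_mulV : left_inverse free_one free_inv free_mul.
Proof.
case=> w rw; apply/val_inj => /=; elim: w rw => //= t w IH rw.
rewrite rev_cons foldr_rcons /= letter_invK eqxx.
exact: IH (path_sorted rw).
Qed.

Lemma free_invK : involutive free_inv.
Proof.
move=> x; apply/val_inj; rewrite /= map_rev revK -map_comp.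
by rewrite (eq_map letter_invK) map_id.
Qed.

Lemma free_mulrV : right_inverse free_one free_inv free_mul.
Proof. by move=> x; rewrite -[x in free_mul x _]free_invK free_mulV. Qed.

HB.instance Definition _ :=
  isGroup.Build free_group free_mulA free_mul1 free_mulr1 free_mulV free_mulrV.

Definition free_gen (i : I) : free_group := @FreeGroup [:: (i, true)] isT.

End FreeGroup.

(* Positions are counted from 0, so that i : 'I_n.-1 stands for the generator
   s_(i+1), which exchanges the entries at positions i and i+1. *)
Section Adjacent.
Variable n : nat.
Implicit Types (i : 'I_n.-1) (x y : free_group 'I_n.-1).

Lemma pos_next_subproof i : (i.+1 < n)%N.
Proof. by case: n i => [|m] []. Qed.

Definition pos i : 'I_n := Ordinal (ltnW (pos_next_subproof i)).
Definition pos_next i : 'I_n := Ordinal (pos_next_subproof i).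

Definition adj i : 'S_n := tperm (pos i) (pos_next i).

(* The product of 'S_n in perm.v is (s * t) j = t (s j); the factors are
   therefore reversed, so that perm_of_free is a morphism for composition of
   functions (lemma perm_of_freeM). *)
Definition perm_of_free x : 'S_n := foldr (fun t s => s * adj t.1)%g 1%g x.

Lemma perm_of_free_gen i : perm_of_free (free_gen i) = adj i.
Proof. by rewrite /perm_of_free /= mul1g. Qed.

Lemma perm_of_free1 : perm_of_free 1%g = 1%g.
Proof. by []. Qed.

Lemma perm_of_freeM x y :
  perm_of_free (x * y)%g =1 perm_of_free x \o perm_of_free y.
Proof.
suff -> : perm_of_free (x * y)%g = (perm_of_free y * perm_of_free x)%g.
  by move=> j; rewrite permM.
rewrite /perm_of_free [word_of _]/=; elim: (word_of x) => [|t w IH] /=.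
  by rewrite mulg1.
rewrite mulgA -IH; case: (foldr _ _ w) => [//|u v] /=.
by case: eqP => //= ->; rewrite /= -mulgA /adj tperm2 mulg1.
Qed.

End Adjacent.

Lemma perm_of_free_surj n (s : 'S_n) : exists x, perm_of_free x = s.
Proof.
pose im : {set 'S_n} := <<[set adj i | i : 'I_n.-1]>>%g.
have imP u : u \in im -> exists x, perm_of_free x = u.
  case/gen_prodgP=> k [c cP ->]; elim: k c cP => [|k IH] c cP.
    by exists 1%g; rewrite big_ord0.
  have [x xE] := IH _ (fun l => cP (lift ord0 l)).
  have /imsetP[i _ iE] := cP ord0.
  exists (x * free_gen i)%g; apply/permP => j.
  by rewrite perm_of_freeM perm_of_free_gen big_ord_recl permM -iE /= -xE.
move/(_ s): imP; apply; rewrite {}/im; case: n s => [|m] s.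
  by rewrite (_ : s = 1%g) ?group1 //; apply/permP; case.
set im := <<_>>%g; suff: [set: 'S_m.+1] \subset im.
  by move/subsetP; apply; rewrite inE.
rewrite -(gen_tperm ord0) gen_subG; apply/subsetP => _ /imsetP[[k km] _ ->].
elim: k km => [|k IH] km.
  by rewrite (_ : Ordinal km = ord0) ?tperm1 ?group1 //; apply/val_inj.
have km' := ltnW km; have := IH km'.
have a_im : adj (Ordinal (km : k < m.+1.-1)%N) \in im by apply/mem_gen/imset_f.
case: k {IH} km km' a_im => [|k] km km' a_im IHk.
  rewrite (_ : tperm _ _ = adj (Ordinal (km : 0 < m.+1.-1)%N)) //.
  by congr tperm; apply/val_inj.
set a := Ordinal (km : k.+1 < m.+1.-1)%N in a_im.
have aE : Ordinal km' = pos a by apply/val_inj.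
have bE : Ordinal km = pos_next a by apply/val_inj.
have := groupJ IHk a_im; rewrite tpermJ aE bE /adj tpermL tpermD //.
Qed.

Record pm1 := Pm1 {
  pm1_val :> int;
  pm1_valP : pm1_val \in [:: 1; -1]
}.

HB.instance Definition _ := [isSub for pm1_val].
HB.instance Definition _ := [Countable of pm1 by <:].

Definition pm1_one : pm1 := @Pm1 1 isT.

Lemma pm1_mul_subproof (a b : pm1) : (a : int) * (b : int) \in [:: 1; -1].
Proof.
by case: a b => a + [b]; rewrite /= !inE => /orP[]/eqP-> /orP[]/eqP->.
Qed.

Definition pm1_mul (a b : pm1) : pm1 := Pm1 (pm1_mul_subproof a b).

Lemma pm1_sign_subproof (m : int) : (-1 : int) ^ m \in [:: 1; -1].
Proof.
case: m => k; rewrite ?NegzE -?exprnP -?exprnN -signr_odd; case: odd => //.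
Qed.

Definition pm1_sign (m : int) : pm1 := Pm1 (pm1_sign_subproof m).

Section Kappa.
Variables (n : nat) (T : Type) (deg : T -> int) (f : n.-tuple T).

Record perms_of := PermsOf {
  perm_seq :> n.-tuple T;
  perm_seqP : exists rho : 'S_n,
    forall i, tnth perm_seq i = tnth f ((rho^-1)%g i)
}.

Definition swap_seq (i : 'I_n.-1) (g : n.-tuple T) : n.-tuple T :=
  [tuple tnth g (adj i j) | j < n].

Lemma swap_subproof i (g : perms_of) : exists rho : 'S_n,
  forall j, tnth (swap_seq i g) j = tnth f ((rho^-1)%g j).
Proof.
have [rho rhoP] := perm_seqP g; exists (rho * adj i)%g => j.
by rewrite tnth_mktuple rhoP invMg permM /adj tpermV.
Qed.

Definition swap_adj i g : perms_of := PermsOf (swap_subproof i g).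

(* s_i and its inverse act in the same way, so the sign of a letter is ignored,
   as it is in perm_of_free and kappa_letter. *)
Definition free_act_word (w : seq ('I_n.-1 * bool)) (g : perms_of) : perms_of :=
  foldr (fun t => swap_adj t.1) g w.

Definition free_act (x : free_group 'I_n.-1) (g : perms_of) :=
  free_act_word x g.

Lemma tnth_free_act x g j :
  tnth (free_act x g) j = tnth g (((perm_of_free x)^-1)%g j).
Proof.
rewrite /free_act /perm_of_free; elim: (word_of x) j => [|t w IH] j /=.
  by rewrite invg1 perm1.
by rewrite tnth_mktuple IH invMg permM /adj tpermV.
Qed.

Lemma free_act1 g : free_act 1%g g = g.
Proof. by []. Qed.

Lemma free_actM x y g :
  free_act (x * y)%g g = free_act x (free_act y g) :> n.-tuple T.
Proof.
apply: eq_from_tnth => j; rewrite !tnth_free_act; congr (tnth g _).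
rewrite -[j in LHS](permKV (perm_of_free x)).
rewrite -[X in perm_of_free x X](permKV (perm_of_free y)).
by rewrite -[perm_of_free x _]perm_of_freeM permK.
Qed.

Definition kappa_letter (t : 'I_n.-1 * bool) (g : perms_of) : pm1 :=
  pm1_sign (deg (tnth g (pos t.1)) * deg (tnth g (pos_next t.1))).

Fixpoint kappa_word (w : seq ('I_n.-1 * bool)) (g : perms_of) : pm1 :=
  if w is t :: w' then
    pm1_mul (kappa_letter t (free_act_word w' g)) (kappa_word w' g)
  else pm1_one.

Definition kappa (x : free_group 'I_n.-1) (g : perms_of) : pm1 :=
  kappa_word x g.

End Kappa.

(* Main.v *)
(** The sign of [x] at [g] is (-1)^m, where m is the sum of |g_i||g_j| over the
    inversions (i, j) of the permutation of [x]. Indeed, multiplying by an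
    adjacent transposition on the left adds or removes exactly one inversion,
    the pair of indices of the two symbols being exchanged, and adding or
    subtracting |g_i||g_j| in the exponent has the same effect on the sign. *)
Require Import Defs.
From mathcomp Require Import all_boot all_order all_algebra all_fingroup.
From mathcomp Require Import zify.

Set Implicit Arguments.
Unset Strict Implicit.
Unset Printing Implicit Defensive.

Import GRing.Theory.
Local Open Scope ring_scope.

Lemma pm1_sign0 : pm1_sign 0 = pm1_one.
Proof. exact/val_inj. Qed.

Lemma pm1_signD a b : pm1_sign (a + b) = pm1_mul (pm1_sign a) (pm1_sign b).
Proof. by apply/val_inj; exact: exprzDr. Qed.

Lemma pm1_signN a : pm1_sign (- a) = pm1_sign a.
Proof. by apply/val_inj; rewrite /= -exprz_inv invrN1. Qed.

(** No index lies strictly between [pos i] and [pos_next i], so exchanging them alters no other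
    comparison. *)
Lemma adj_ltn n (i : 'I_n.-1) (x y : 'I_n) :
    (x, y) != (pos i, pos_next i) -> (x, y) != (pos_next i, pos i) ->
  (adj i x < adj i y)%N = (x < y)%N.
Proof.
rewrite /adj !xpair_eqE; case: tpermP => [->|->|/eqP + /eqP +];
  case: tpermP => [->|->|/eqP + /eqP +]; rewrite ?eqxx // -!val_eqE /=; lia.
Qed.

Section InversionSum.
Variables (n : nat) (c : 'I_n -> 'I_n -> int).
Hypothesis c_sym : forall a b, c a b = c b a.

Definition inversion (s : 'S_n) (p : 'I_n * 'I_n) : bool :=
  ((p.1 < p.2) && (s p.2 < s p.1))%N.

Definition inversion_sum (s : 'S_n) : int :=
  \sum_(p | inversion s p) c p.1 p.2.

Lemma inversion_sum1 : inversion_sum 1%g = 0.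
Proof.
by rewrite /inversion_sum big_pred0 // => p; rewrite /inversion !perm1; lia.
Qed.

(** Here [s] acts first, so only the pair of [a] and [b] changes status: it becomes an inversion if
    [a < b] and ceases to be one otherwise. *)
Lemma inversion_sum_adj (s : 'S_n) (i : 'I_n.-1) :
  let a := (s^-1)%g (pos i) in let b := (s^-1)%g (pos_next i) in
  inversion_sum (s * adj i)%g =
    (if (a < b)%N then c a b else - c a b) + inversion_sum s.
Proof.
move=> a b.
have sa : s a = pos i by rewrite permKV.
have sb : s b = pos_next i by rewrite permKV.
have ab : a != b by rewrite (inj_eq perm_inj) -val_eqE /= neq_ltn leqnn.
have ba_ab : (b, a) != (a, b) by rewrite xpair_eqE eq_sym (negbTE ab).
(* Both orders are split off, as either of [a] and [b] may be the smaller. *)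
have split_ab u : inversion_sum u =
    (if inversion u (a, b) then c a b else 0) +
    ((if inversion u (b, a) then c b a else 0) +
     \sum_(p | (p != (a, b)) && (p != (b, a)))
        (if inversion u p then c p.1 p.2 else 0)).
  by rewrite /inversion_sum big_mkcond (bigD1 (a, b)) //= (bigD1 (b, a)).
rewrite !split_ab; set rest := (X in _ = _ + (_ + (_ + X))).
rewrite (_ : \sum_(_ | _) _ = rest); last first.
  (* [adj_ltn] is applied to [s y] and [s x], which swaps the roles of the two excluded pairs. *)
  apply: eq_bigr => -[x y]; rewrite /inversion /= !permM => /andP[xy_ab xy_ba].
  rewrite adj_ltn // -?sa -?sb !xpair_eqE !(inj_eq perm_inj) andbC -xpair_eqE //.
rewrite /inversion /= !permM sa sb /adj tpermL tpermR /= ltnSn.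
rewrite [(i.+1 < i)%N]ltnNge leqnSn !andbF !andbT [c b a]c_sym.
have := ab; rewrite -val_eqE /=.
by case: ltngtP => //= _ _; rewrite ?add0r // ?addKr.
Qed.

End InversionSum.

Theorem proposition2p2 (n : nat) (n_ge2 : (2 <= n)%N) (T : Type)
    (deg : T -> int) (f : n.-tuple T) :
  exists kappa_bar : 'S_n -> perms_of f -> pm1,
    forall (x : free_group 'I_n.-1) (g : perms_of f),
      kappa_bar (perm_of_free x) g = kappa deg x g.
Proof.
pose c (g : perms_of f) a b := deg (tnth g a) * deg (tnth g b).
have c_sym g a b : c g a b = c g b a by rewrite /c mulrC.
exists (fun s g => pm1_sign (inversion_sum (c g) s)) => -[w rw] g.
rewrite /kappa /=; elim: w rw => [|t w IH] rw /=.
  by rewrite /perm_of_free /= inversion_sum1 pm1_sign0.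
have rw' : reduced w := path_sorted rw.
rewrite -(IH rw') {IH}.
have -> : perm_of_free (FreeGroup rw) =
          (perm_of_free (FreeGroup rw') * adj t.1)%g by [].
rewrite inversion_sum_adj // pm1_signD; congr pm1_mul.
(* The symbols that [t] exchanges after [w] has acted sit in [g] at the preimages of [pos t.1] and
   [pos_next t.1]. *)
rewrite /kappa_letter -[free_act_word w g]/(free_act (FreeGroup rw') g).
rewrite !tnth_free_act -/(c g _ _).
by case: ifP; rewrite ?pm1_signN.
Qed.
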